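(* Let $D=[\mathbb R]^{<\omega}$ denote the set of all finite subsets of $\mathbb R$, ordered by inclusion, and let $X_D=D\cup\{\infty\}$ (with $\infty\notin D$) carry the one-point convergence topology $\beta_D$, i.e. the topology having as a subbase all sets $\uparrow x$ and $\uparrow x\cup\{\infty\}$ for $x\in D$, where $\uparrow x=\{y\in D:x\subseteq y\}$. Then $X_D\in\mathbf{Top}_{\mathbb D}$ but $X_D\notin\mathbf{Top}_{\mathbb K}$. Consequently, $\mathbf{Top}_{\mathbb D}\not\subseteq\mathbf{Top}_{\mathbb K}$.
   Context: All spaces are $T_0$; $\mathbf{Top}$ is the category of $T_0$ spaces and continuous maps. For a class $\mathbb C$ of $T_0$ spaces, a subset $U$ of a space $X$ is $\mathbb C$-open if $k^{-1}(U)$ is open in $C$ for every $C\in\mathbb C$ and every continuous map $k:C\to X$; $X$ is $\mathbb C$-generated if every $\mathbb C$-open subset is open; $\mathbf{Top}_{\mathbb C}$ is the full subcategory of $\mathbf{Top}$ of $\mathbb C$-generated spaces. $\mathbb D$ is the class of all one-point convergence spaces $(D\cup\{\infty\},\beta_D)$, where $D$ is a (non-empty) directed poset, $\infty\notin D$, and $\beta_D$ is the topology with subbase all $\uparrow x$ and $\uparrow x\cup\{\infty\}$ for $x\in D$, with $\uparrow x=\{y\in D:x\le y\}$. ($\mathbf{Top}_{\mathbb D}$ is the category of monotone determined spaces.) $\mathbf{Top}_{\mathbb K}$ is the category of compact Hausdorff generated spaces, i.e. $\mathbb K$ is the class of compact Hausdorff spaces. *)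

(* Defs.v *)
From HB Require Import structures.
From mathcomp Require Import all_boot all_order finmap.
From mathcomp Require Import all_classical all_reals all_analysis.

Set Implicit Arguments.
Unset Strict Implicit.
Unset Printing Implicit Defensive.

Local Open Scope classical_set_scope.
Local Open Scope order_scope.

Fact fset_display : Order.disp_t. Proof. exact: Order.Disp. Qed.

Section FsetOrder.
Variable K : choiceType.

Let fsubset_anti : antisymmetric (@fsubset K).
Proof. by move=> A B; rewrite -eqEfsubset => /eqP. Qed.

HB.instance Definition _ := Order.Le_isPOrder.Build fset_display {fset K}
  (@fsubset_refl K) fsubset_anti (@fsubset_trans K).

End FsetOrder.

Definition directed d (D : porderType d) : Prop :=
  [set: D] !=set0 /\ forall x y : D, exists2 z : D, x <= z & y <= z.

(* The carrier is D plus a new point; None plays the role of infinity. *)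
Definition convergence_space d (D : porderType d) : Type := option D.

Section ConvergenceSpace.
Context {d : Order.disp_t} {D : porderType d}.
Local Notation X := (convergence_space D).

Definition up (x : D) : set X := Some @` [set y | x <= y].

Definition convergence_subbase : set (set X) :=
  [set U | exists x : D, U = up x \/ U = up x `|` [set None]].

HB.instance Definition _ := Choice.on X.
HB.instance Definition _ :=
  isSubBaseTopological.Build X convergence_subbase id.

End ConvergenceSpace.

Definition homeomorphic (X Y : topologicalType) : Prop :=
  exists (f : X -> Y) (g : Y -> X),
    [/\ cancel f g, cancel g f, continuous f & continuous g].

(* Classes of spaces are predicates [topologicalType -> Prop] rather than sets
   [set topologicalType], which keeps universe constraints minimal. *)
Definition C_open (C : topologicalType -> Prop) (X : topologicalType)
    (U : set X) : Prop :=
  forall (T : topologicalType) (k : T -> X),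
    C T -> continuous k -> open (k @^-1` U).

Definition C_generated (C : topologicalType -> Prop) (X : topologicalType) :
    Prop :=
  forall U : set X, C_open C U -> open U.

(* The objects of Top_C; the subcategory being full, these determine it. *)
Definition Top_gen (C : topologicalType -> Prop) (X : topologicalType) : Prop :=
  kolmogorov_space X /\ C_generated C X.

(* D and its extra point are arbitrary objects, so that a space homeomorphic to
   a one-point convergence space is itself one, by transport of structure. *)
Definition convergence_class (X : topologicalType) : Prop :=
  exists (d : Order.disp_t) (D : porderType d),
    directed D /\ homeomorphic X (convergence_space D).

Definition compact_hausdorff_class (X : topologicalType) : Prop :=
  compact [set: X] /\ hausdorff_space X.

(* Main.v *)
Require Import Defs.
From mathcomp Require Import all_boot all_order all_algebra finmap.
From mathcomp Require Import all_classical all_reals all_analysis.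

(** Every space of a class is generated by that class, so the point is that
    [X = convergence_space {fset R}] is not generated by compact Hausdorff
    spaces. The witness is the singleton of the point [None] at infinity.

    It is not open in [X]: a neighbourhood of [None] contains some [up A]
    ([nbhs_None_up]).

    It is nevertheless open as seen from any compact Hausdorff space [T] with a
    continuous map [k : T -> X]. Put [F := k @^-1` [set None]], which is closed,
    and for each real [r] put [W r := k @^-1` (up [fset r] `|` [set None])],
    an open neighbourhood of [F]. A point [t] outside [F] is sent to a finite
    set, and [W r t] means that [r] belongs to that set; so [t] lies in only
    finitely many of the uncountably many sets [W r]. In a compact Hausdorff
    space such a family can exist only around an open set
    ([open_point_finite_nbhs]). Indeed countably many of the [W r] already
    intersect in [F]; after shrinking these to closed neighbourhoods,
    compactness puts the intersection of finitely many of them inside any given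
    [W r], and since there are only countably many initial segments of a
    sequence and uncountably many [r], one finite intersection works for
    infinitely many [r] at once.
    That intersection is a neighbourhood of [F] which point-finiteness forces
    to be contained in [F].

    Uncountability is essential: for the finite subsets of [nat], the sequence
    of the sets [{0, ..., n}] converges to infinity, and extending it to the
    one-point compactification of [nat] pulls the point at infinity back to a
    singleton that is not open. *)

Set Implicit Arguments.
Unset Strict Implicit.
Unset Printing Implicit Defensive.

Import Order.TTheory GRing.Theory Num.Theory.

Local Open Scope order_scope.
Local Open Scope classical_set_scope.

Lemma uncountable_infinite_fiber (I : Type) (f : I -> nat) :
  ~ countable [set: I] -> exists n, infinite_set (f @^-1` [set n]).
Proof.
move=> cI; apply: contrapT => /forallNP fin; apply: cI.
have -> : [set: I] = \bigcup_n f @^-1` [set n].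
  by apply/seteqP; split=> // i _; exists (f i).
apply: bigcup_countable => // n _.
by apply: finite_set_countable; exact: contrapT (fin n).
Qed.

Lemma uncountable_real (R : realType) : ~ countable [set: R].
Proof.
move=> cR; have c01 : countable (`[0%R : R, 1%R]%classic).
  by apply: sub_countable cR; exact: subset_card_le.
have := countable_lebesgue_measure0 c01.
rewrite lebesgue_measure_itv /= lte_fin ltr01 oppr0 adde0 => /eqP.
by rewrite eqe oner_eq0.
Qed.

(** Normality and compactness reduce the uncountable family to a countable list
    of closed neighbourhoods [closure (C (r m))] of [F]: each [W i] contains the
    intersection of the first [N i] of them. Since [N] takes countably many
    values, some [n] is equal to [N i] for infinitely many [i]; a point in the
    first [n] closed neighbourhoods is then in infinitely many [W i], hence in
    [F]. *)
Lemma open_point_finite_nbhs (T : topologicalType) (I : Type) (F : set T)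
    (W : I -> set T) :
  compact [set: T] -> hausdorff_space T -> ~ countable [set: I] ->
  closed F -> (forall i, open (W i)) -> (forall i, F `<=` W i) ->
  (forall t, ~ F t -> finite_set [set i | W i t]) ->
  open F.
Proof.
move=> cT hT uI clF oW FW finW.
have /choice[C CP] (i : I) :
    exists A, set_nbhs F A /\ closure A `<=` W i.
  have /(compact_normal hT cT clF) [A FA AW] : set_nbhs F (W i).
    by move=> x Fx; apply: open_nbhs_nbhs; split; [exact: oW|exact: FW Fx].
  by exists A.
have [r rinj] : exists r : nat -> I, injective r.
  have /infiniteP/card_leP[g] : infinite_set [set: I].
    by move=> /finite_set_countable.
  exists (val \o g \o to_setT) => m n /= /val_inj gmn.
  have /(congr1 val) // : to_setT m = to_setT n.
  by apply: (@inj _ _ _ g) gmn; exact: mem_set.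
have /choice[N NP] (i : I) : exists n, forall t, ~ W i t ->
    exists2 m, (m < n)%N & ~ closure (C (r m)) t.
  have cWi : compact (~` W i).
    by apply: subclosed_compact cT _ => //; exact: open_closedC.
  (* The complement of [W i] is compact and is covered by the open sets
     [~` closure (C (r m))], because [t] outside [F] is missed by some
     [W (r m)], the sequence [r] being injective. *)
  have : \forall n \near \oo, ~` W i `<=`
      (fun t => exists2 m, (m < n)%N & ~ closure (C (r m)) t).
    apply: ((compact_near_coveringP _).1 cWi) => t Wt.
    have Ft : ~ F t by move=> Ft; apply: Wt; exact: FW Ft.
    have [m Wm] : exists m, ~ W (r m) t.
      apply: contrapT => /forallNP rW; apply: infinite_nat.
      apply: sub_finite_set (finite_preimage (in2W rinj) (finW t Ft)) => m _ /=.
      exact: contrapT (rW m).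
    have nCm : ~ closure (C (r m)) t by move=> /(CP (r m)).2.
    exists (~` closure (C (r m)), [set n | m < n]%N) => /=.
      split; last by exists m.+1.
      apply: open_nbhs_nbhs; split=> //.
      by apply: closed_openC; exact: closed_closure.
    by move=> [s n] /= [Cs mn]; exists m.
  by case=> n _ /(_ n) /= nP; exists n => t Wt; exact: nP.
have [n infn] := uncountable_infinite_fiber N uI.
have CF t : (forall m, (m < n)%N -> closure (C (r m)) t) -> F t.
  move=> Ct; apply: contrapT => /finW; apply: contra_not infn.
  apply: sub_finite_set => i /= Ni; apply: contrapT => /NP [m].
  by rewrite Ni => /Ct.
rewrite openE => x Fx; rewrite /interior.
have : \forall t \near x, forall m, (m < n)%N -> C (r m) t.
  elim: n {infn CF} => [|n IH]; first by apply: nearW.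
  have Cn : nbhs x (C (r n)) by exact: (CP (r n)).1.
  near=> t => m; rewrite ltnS leq_eqVlt => /orP[/eqP->|]; first by near: t.
  by move: m; near: t.
apply: filterS => t Ct; apply: CF => m mn.
by apply: subset_closure; exact: Ct.
Unshelve. all: by end_near. Qed.

Section ConvergenceSpaceTheory.
Context {d : Order.disp_t} {D : porderType d}.
Local Notation X := (convergence_space D).

Lemma open_convergence_subbase (U : set X) :
  convergence_subbase U -> open U.
Proof.
move=> sU; exists [set U]; last by rewrite bigcup_set1.
move=> _ ->; exists [fset U]%fset; last by rewrite set_fset1 bigcap_set1.
by move=> V /fset1P ->; exact: mem_set.
Qed.

Lemma open_up (x : D) : open (up x).
Proof. by apply: open_convergence_subbase; exists x; left. Qed.

Lemma open_upN (x : D) : open (up x `|` [set None]).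
Proof. by apply: open_convergence_subbase; exists x; right. Qed.

Lemma closed_None : closed [set None : X].
Proof.
have -> : [set None : X] = ~` \bigcup_x up x.
  apply/seteqP; split=> [_ -> [x _ [y _]] //|[x|//] nx].
  by case: nx; exists x => //; exists x => /=.
by apply: open_closedC; apply: bigcup_open => x _; exact: open_up.
Qed.

(** The sets [up x] form a base of a filter because [D] is directed; hence
    finitely many subbasic neighbourhoods of [None] contain a common [up x]. *)
Lemma nbhs_None_up (U : set X) :
  directed D -> nbhs (None : X) U -> exists x : D, up x `<=` U.
Proof.
move=> [[x0 _] dirD]; rewrite nbhsE => -[_ [[B sB <-] [V BV VN]] BU].
have FF : Filter (filter_from [set: D] (@up d D)).
  apply: filter_from_filter => [|x y _ _]; first by exists x0.
  have [z xz yz] := dirD x y; exists z => // _ [w zw <-].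
  by split; exists w => //=; exact: le_trans zw.
suff [x _ xV] : filter_from [set: D] (@up d D) V.
  by exists x => p /xV Vp; apply: BU; exists V.
have [A sA AV] := sB _ BV; rewrite -AV; apply: filter_bigI => W AW.
have WN : W None by move: VN; rewrite -AV => /(_ W AW).
have := sA _ AW; rewrite inE => -[x [Wx|Wx]].
  by move: WN; rewrite /= Wx => -[].
by exists x => //; rewrite Wx; exact: subsetUl.
Qed.

Lemma not_open_None : directed D -> ~ open [set None : X].
Proof.
move=> dirD oN; have : nbhs (None : X) [set None] by exact: open_nbhs_nbhs.
move=> /(nbhs_None_up dirD) [x] /(_ (Some x)) upx.
by have // : Some x = None by apply: upx; exists x => /=.
Qed.

Lemma kolmogorov_convergence_space : kolmogorov_space X.
Proof.
have upI (x : D) : up x (Some x : X) by exists x => /=.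
have nup (x : D) : up x \in nbhs (Some x : X).
  by apply: mem_set; apply: open_nbhs_nbhs; split; [exact: open_up|].
move=> [x|] [y|] // xy.
- have [xley|xley] := boolP (x <= y).
    exists (up y); right; split=> //; apply: mem_set => -[z /= yz [zx]].
    by move/eqP: xy; apply; congr Some; apply: le_anti; rewrite xley -zx yz.
  exists (up x); left; split=> //; apply: mem_set => -[z /= xz [zy]].
  by move: xley; rewrite -zy xz.
- by exists (up x); left; split=> //; apply: mem_set => -[].
- by exists (up y); right; split=> //; apply: mem_set => -[].
Qed.

Lemma convergence_class_convergence_space :
  directed D -> convergence_class X.
Proof.
move=> dirD; exists d, D; split=> //; exists id, id.
by split=> // x; exact: cvg_id.
Qed.

End ConvergenceSpaceTheory.

Lemma C_generated_self (C : topologicalType -> Prop) (X : topologicalType) :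
  C X -> C_generated C X.
Proof. by move=> CX U /(_ X id CX); apply => x; exact: cvg_id. Qed.

Lemma directed_fset (K : choiceType) : directed {fset K}.
Proof.
split; first by exists fset0.
by move=> A B; exists (A `|` B)%fset; [exact: fsubsetUl|exact: fsubsetUr].
Qed.

Lemma compact_hausdorff_open_None_fset (K : choiceType) :
  ~ countable [set: K] ->
  C_open compact_hausdorff_class [set None : convergence_space {fset K}].
Proof.
move=> uK T k [cT hT] kC.
pose W r : set T := k @^-1` (up [fset r]%fset `|` [set None]).
apply: (@open_point_finite_nbhs T K _ W) => //.
- exact: (continuous_closedP k).1 kC _ closed_None.
- by move=> r; exact: (continuousP k).1 kC _ (open_upN _).
- by move=> r t; right.
move=> t; rewrite /W /=; case: (k t) => [A _|//].
apply: sub_finite_set (finite_fset A) => r /= [[B /= rB [<-]]|//].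
by move: rB; rewrite /Order.le /= fsub1set.
Qed.

Theorem theorem16 (R : realType) :
  [/\ Top_gen convergence_class (convergence_space {fset R}),
      ~ Top_gen compact_hausdorff_class (convergence_space {fset R})
    & ~ (forall X : topologicalType,
           Top_gen convergence_class X -> Top_gen compact_hausdorff_class X)].
Proof.
have XD : Top_gen convergence_class (convergence_space {fset R}).
  split; first exact: kolmogorov_convergence_space.
  apply: C_generated_self; apply: convergence_class_convergence_space.
  exact: directed_fset.
have XK : ~ Top_gen compact_hausdorff_class (convergence_space {fset R}).
  move=> [_ genX]; apply: (not_open_None (@directed_fset R)); apply: genX.
  by apply: compact_hausdorff_open_None_fset; exact: uncountable_real.
by split=> // /(_ _ XD).
Qed.
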